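(* Let $\mathbb A$ be a symmetric (strict) monoidal category with object set $\mathbb A_0$, let $\mathbb A^{\circ\bullet}$ be its monoid of exchanges, and let $\ulcorner\mathbb A\urcorner$ be its free cornering, with crossing cells $\chi_{U,A}:(U;A;A;U)$. For all $U\in\mathbb A^{\circ\bullet}$ and $A,B\in\mathbb A_0$ the following equations hold in $\ulcorner\mathbb A\urcorner$: (i) $\chi_{U,A\otimes B}=\chi_{U,A}\mid\chi_{U,B}$; (ii) $\chi_{U,I}=id_U$.
   Context: Monoidal categories are strict, and composites are in diagrammatic order ($fg$ is first $f$, then $g$). $\sigma_{A,B}:A\otimes B\to B\otimes A$ is the braiding. A single-object double category $\mathbb D$ has a horizontal edge monoid $(\mathbb D_H,\otimes,I)$, a vertical edge monoid $(\mathbb D_V,\otimes,I)$, and for $A,B\in\mathbb D_H$, $U,W\in\mathbb D_V$ a set of cells $(U;A;B;W)$ (left; top; bottom; right boundary). For $\alpha:(U;A;B;V)$ and $\beta:(V;A';B';W)$ there is a horizontal composite $\alpha\mid\beta:(U;A\otimes A';B\otimes B';W)$; for $\alpha:(U;A;C;W)$ and $\beta:(U';C;B;W')$ a vertical composite $\frac{\alpha}{\beta}:(U\otimes U';A;B;W\otimes W')$. Both are associative and unital, with horizontal units $id_U:(U;I;I;U)$ and vertical units $1_A:(I;A;A;I)$, where $id_I=1_I$, $1_{A\otimes B}=1_A\mid 1_B$, $id_{U\otimes W}=\frac{id_U}{id_W}$, and interchange $\frac{\alpha}{\beta}\mid\frac{\gamma}{\delta}=\frac{\alpha\mid\gamma}{\beta\mid\delta}$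 holds. Exchanges: $\mathbb A^{\circ\bullet}$ is the free monoid (operation $\otimes$, unit $I$) on the set of symbols $A^\circ,A^\bullet$ for $A\in\mathbb A_0$. Free cornering: $\ulcorner\mathbb A\urcorner$ is the free single-object double category with horizontal edge monoid $(\mathbb A_0,\otimes,I)$, vertical edge monoid $\mathbb A^{\circ\bullet}$, and the following generating cells and equations. For each $f:A\to B$ in $\mathbb A$ a cell $\ulcorner f\urcorner:(I;A;B;I)$ (also written $f$), with $\ulcorner fg\urcorner=\frac{\ulcorner f\urcorner}{\ulcorner g\urcorner}$, $\ulcorner 1_A\urcorner=1_A$, $\ulcorner f\otimes g\urcorner=\ulcorner f\urcorner\mid\ulcorner g\urcorner$. For each $A\in\mathbb A_0$ corner cells $\mathsf{get}_L^A:(A^\circ;I;A;I)$, $\mathsf{put}_R^A:(I;A;I;A^\circ)$, $\mathsf{get}_R^A:(I;I;A;A^\bullet)$, $\mathsf{put}_L^A:(A^\bullet;A;I;I)$, with the yanking equations $\mathsf{put}_R^A\mid\mathsf{get}_L^A=1_A$, $\frac{\mathsf{get}_L^A}{\mathsf{put}_R^A}=id_{A^\circ}$, $\mathsf{get}_R^A\mid\mathsf{put}_L^A=1_A$, $\frac{\mathsf{get}_R^A}{\mathsf{put}_L^A}=id_{A^\bullet}$. Crossing cells $\chi_{U,B}:(U;B;B;U)$ are defined by induction on $U$: $\chi_{A^\circ,B}$ is the vertical composite (top to bottom) of $\mathsf{get}_L^A\mid 1_B$, $\sigma_{A,B}$, $1_B\mid\mathsf{put}_R^A$; $\chi_{A^\bullet,B}$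 is the vertical composite (top to bottom) of $1_B\mid\mathsf{get}_R^A$, $\sigma_{B,A}$, $\mathsf{put}_L^A\mid 1_B$; $\chi_{I,B}=1_B$; $\chi_{U\otimes W,B}=\frac{\chi_{U,B}}{\chi_{W,B}}$. *)

(* Defs.v *)
(* Monoids are written multiplicatively, so that the tensor
   product of objects and of exchanges is [_ * _] and the tensor unit is [1].
   All composites are in diagrammatic order. *)
From HB Require Import structures.
From mathcomp Require Import all_boot.
From mathcomp Require Import generic_quotient.
From mathcomp Require Import boolp.

Set Implicit Arguments.
Unset Strict Implicit.
Unset Printing Implicit Defensive.

Local Open Scope group_scope.
Local Open Scope quotient_scope.

(* Strict associativity and unitality are equations between objects, so the
   corresponding equations between arrows or cells are stated along transport.
   Since [monoidType] extends [eqType], the choice of the proofs is immaterial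
   (see [cast4_id]). *)
Definition cast2 (H : Type) (C : H -> H -> Type) A A' B B'
    (eA : A = A') (eB : B = B') (f : C A B) : C A' B' :=
  let: erefl := eA in let: erefl := eB in f.

Definition cast4 (V H : Type) (C : V -> H -> H -> V -> Type)
    U U' A A' B B' W W' (eU : U = U') (eA : A = A') (eB : B = B') (eW : W = W')
    (a : C U A B W) : C U' A' B' W' :=
  let: erefl := eU in let: erefl := eA in
  let: erefl := eB in let: erefl := eW in a.

Arguments cast2 : simpl never.
Arguments cast4 : simpl never.

Lemma cast4_id (V H : eqType) (C : V -> H -> H -> V -> Type) U A B W
    (eU : U = U) (eA : A = A) (eB : B = B) (eW : W = W) (a : C U A B W) :
  cast4 eU eA eB eW a = a.
Proof. by rewrite !eq_axiomK. Qed.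

Record symmoncat := SymMonCat {
  ob :> monoidType;
  hom : ob -> ob -> Type;
  idm : forall A, hom A A;
  comp : forall A B C, hom A B -> hom B C -> hom A C;
  tens : forall A A' B B', hom A A' -> hom B B' -> hom (A * B) (A' * B');
  braid : forall A B, hom (A * B) (B * A);

  compA : forall A B C D (f : hom A B) (g : hom B C) (h : hom C D),
    comp f (comp g h) = comp (comp f g) h;
  comp1f : forall A B (f : hom A B), comp (idm A) f = f;
  compf1 : forall A B (f : hom A B), comp f (idm B) = f;

  tens_id : forall A B, tens (idm A) (idm B) = idm (A * B);
  tens_comp : forall A A' A'' B B' B''
      (f : hom A A') (f' : hom A' A'') (g : hom B B') (g' : hom B' B''),
    tens (comp f f') (comp g g') = comp (tens f g) (tens f' g');
  tensA : forall A A' B B' C C' (f : hom A A') (g : hom B B') (h : hom C C'),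
    cast2 (mulgA A B C) (mulgA A' B' C') (tens f (tens g h))
    = tens (tens f g) h;
  tens1f : forall A A' (f : hom A A'),
    cast2 (mul1g A) (mul1g A') (tens (idm 1) f) = f;
  tensf1 : forall A A' (f : hom A A'),
    cast2 (mulg1 A) (mulg1 A') (tens f (idm 1)) = f;

  braid_nat : forall A A' B B' (f : hom A A') (g : hom B B'),
    comp (tens f g) (braid A' B') = comp (braid A B) (tens g f);
  braid_sym : forall A B, comp (braid A B) (braid B A) = idm (A * B);
  braid_hex : forall A B C,
    cast2 (mulgA A B C) (esym (mulgA B C A)) (braid A (B * C))
    = comp (tens (braid A B) (idm C))
        (cast2 (mulgA B A C) erefl (tens (idm B) (braid A C)))
}.

Arguments idm {s} A : rename.
Arguments braid {s} A B : rename.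

(* Single-object double categories with horizontal edge monoid [H] and vertical
   edge monoid [V]; the boundaries of a cell are listed in the order left, top,
   bottom, right.  [hid U] is the horizontal unit id_U and [vid A] the vertical
   unit 1_A. *)
Record dblcat (H V : monoidType) := DblCat {
  cell :> V -> H -> H -> V -> Type;
  hcomp : forall U V' W A A' B B',
    cell U A B V' -> cell V' A' B' W -> cell U (A * A') (B * B') W;
  vcomp : forall U U' W W' A B C,
    cell U A C W -> cell U' C B W' -> cell (U * U') A B (W * W');
  hid : forall U, cell U 1 1 U;
  vid : forall A, cell 1 A A 1;

  hcompA : forall U V1 V2 W A1 B1 A2 B2 A3 B3
      (a : cell U A1 B1 V1) (b : cell V1 A2 B2 V2) (c : cell V2 A3 B3 W),
    cast4 erefl (mulgA A1 A2 A3) (mulgA B1 B2 B3) erefl (hcomp a (hcomp b c))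
    = hcomp (hcomp a b) c;
  hcomp1c : forall U A B W (a : cell U A B W),
    cast4 erefl (mul1g A) (mul1g B) erefl (hcomp (hid U) a) = a;
  hcompc1 : forall U A B W (a : cell U A B W),
    cast4 erefl (mulg1 A) (mulg1 B) erefl (hcomp a (hid W)) = a;

  vcompA : forall A C1 C2 B U1 W1 U2 W2 U3 W3
      (a : cell U1 A C1 W1) (b : cell U2 C1 C2 W2) (c : cell U3 C2 B W3),
    cast4 (mulgA U1 U2 U3) erefl erefl (mulgA W1 W2 W3) (vcomp a (vcomp b c))
    = vcomp (vcomp a b) c;
  vcomp1c : forall U A B W (a : cell U A B W),
    cast4 (mul1g U) erefl erefl (mul1g W) (vcomp (vid A) a) = a;
  vcompc1 : forall U A B W (a : cell U A B W),
    cast4 (mulg1 U) erefl erefl (mulg1 W) (vcomp a (vid B)) = a;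

  hid1 : hid 1 = vid 1;
  vidM : forall A B, vid (A * B) = hcomp (vid A) (vid B);
  hidM : forall U W, hid (U * W) = vcomp (hid U) (hid W);
  interchange : forall U U' V1 V1' W W' A B C A' B' C'
      (a : cell U A C V1) (b : cell U' C B V1')
      (c : cell V1 A' C' W) (d : cell V1' C' B' W'),
    hcomp (vcomp a b) (vcomp c d) = vcomp (hcomp a c) (hcomp b d)
}.

Arguments hid {H V d} U : rename.
Arguments vid {H V d} A : rename.

(* The free monoid on the symbols A° (left summand) and A• (right summand). *)
Definition exchange (T : choiceType) := seq (T + T).

HB.instance Definition _ (T : choiceType) :=
  Choice.copy (exchange T) (seq (T + T)).
HB.instance Definition _ (T : choiceType) :=
  isMonoid.Build (exchange T) (@catA (T + T)) (@cat0s (T + T)) (@cats0 (T + T)).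

Definition circ (T : choiceType) (A : T) : exchange T := [:: inl A].
Definition bullet (T : choiceType) (A : T) : exchange T := [:: inr A].

(* Double categories equipped with the generating cells of the cornering and
   satisfying its equations.  Boundaries in [exchange] that differ by units
   are convertible, so that only the horizontal boundaries need transport. *)
Record cornering (M : symmoncat) := Cornering {
  cdbl :> dblcat M (exchange M);
  gen : forall A B, hom A B -> cdbl 1 A B 1;
  getL : forall A, cdbl (circ A) 1 A 1;
  putR : forall A, cdbl 1 A 1 (circ A);
  getR : forall A, cdbl 1 1 A (bullet A);
  putL : forall A, cdbl (bullet A) A 1 1;

  gen_comp : forall A B C (f : hom A B) (g : hom B C),
    gen (comp f g) = vcomp (gen f) (gen g);
  gen_id : forall A, gen (idm A) = vid A;
  gen_tens : forall A A' B B' (f : hom A A') (g : hom B B'),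
    gen (tens f g) = hcomp (gen f) (gen g);
  yank_circ_h : forall A,
    cast4 erefl (mulg1 A) (mul1g A) erefl (hcomp (putR A) (getL A)) = vid A;
  yank_circ_v : forall A, vcomp (getL A) (putR A) = hid (circ A);
  yank_bullet_h : forall A,
    cast4 erefl (mul1g A) (mulg1 A) erefl (hcomp (getR A) (putL A)) = vid A;
  yank_bullet_v : forall A, vcomp (getR A) (putL A) = hid (bullet A)
}.

Arguments getL {M c} A : rename.
Arguments putR {M c} A : rename.
Arguments getR {M c} A : rename.
Arguments putL {M c} A : rename.

(* The crossing cells, by recursion on the list of symbols; [chi1], [chiC],
   [chiB] and [chiM] recover the clauses for I, A°, A• and U ⊗ W. *)
Section Crossing.
Variables (M : symmoncat) (D : cornering M).

Definition chi_circ (A B : M) : D (circ A) B B (circ A) :=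
  cast4 erefl (mul1g B) (mulg1 B) erefl
    (vcomp (hcomp (getL A) (vid B))
      (vcomp (gen D (braid A B)) (hcomp (vid B) (putR A)))).

Definition chi_bullet (A B : M) : D (bullet A) B B (bullet A) :=
  cast4 erefl (mulg1 B) (mul1g B) erefl
    (vcomp (hcomp (vid B) (getR A))
      (vcomp (gen D (braid B A)) (hcomp (putL A) (vid B)))).

Definition chi_symb (s : M + M) (B : M) : D [:: s] B B [:: s] :=
  match s with inl A => chi_circ A B | inr A => chi_bullet A B end.

Fixpoint chi (U : exchange M) (B : M) : D U B B U :=
  match U with
  | [::] => vid B
  | s :: U' => vcomp (chi_symb s B) (chi U' B)
  end.

Lemma chiC A B : chi (circ A) B = chi_circ A B.
Proof. by rewrite -[RHS]vcompc1 cast4_id. Qed.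

Lemma chiB A B : chi (bullet A) B = chi_bullet A B.
Proof. by rewrite -[RHS]vcompc1 cast4_id. Qed.

Lemma chi1 B : chi 1 B = vid B.
Proof. by []. Qed.

Lemma chiM U W B : chi (U * W) B = vcomp (chi U B) (chi W B).
Proof.
elim: U => [|s U IH]; first by rewrite -[LHS]vcomp1c cast4_id.
have := vcompA (chi_symb s B) (chi U B) (chi W B).
by rewrite cast4_id -IH.
Qed.

End Crossing.

Section FreeCornering.
Variable M : symmoncat.

Notation V := (exchange M).

Inductive term : V -> M -> M -> V -> Type :=
| tgen A B (f : hom A B) : term 1 A B 1
| tgetL (A : M) : term (circ A) 1 A 1
| tputR (A : M) : term 1 A 1 (circ A)
| tgetR (A : M) : term 1 1 A (bullet A)
| tputL (A : M) : term (bullet A) A 1 1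
| thid U : term U 1 1 U
| tvid A : term 1 A A 1
| thcomp U V1 W A A' B B' :
    term U A B V1 -> term V1 A' B' W -> term U (A * A') (B * B') W
| tvcomp U U' W W' A B C :
    term U A C W -> term U' C B W' -> term (U * U') A B (W * W').

(* The least congruence containing the equations of double categories and of
   cornerings.  It relates terms whose boundaries are only provably equal
   (see [teq_boundary]), so no transport occurs in the equations. *)
Inductive teq : forall U A B W, term U A B W ->
                forall U' A' B' W', term U' A' B' W' -> Prop :=
| teq_refl U A B W (a : term U A B W) : teq a a
| teq_sym U A B W U' A' B' W' (a : term U A B W) (b : term U' A' B' W') :
    teq a b -> teq b a
| teq_trans U A B W U' A' B' W' U'' A'' B'' W''
    (a : term U A B W) (b : term U' A' B' W') (c : term U'' A'' B'' W'') :
    teq a b -> teq b c -> teq a c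
| teq_hcomp U1 V1 W1 A1 A1' B1 B1' U2 V2 W2 A2 A2' B2 B2'
    (a1 : term U1 A1 B1 V1) (b1 : term V1 A1' B1' W1)
    (a2 : term U2 A2 B2 V2) (b2 : term V2 A2' B2' W2) :
    teq a1 a2 -> teq b1 b2 -> teq (thcomp a1 b1) (thcomp a2 b2)
| teq_vcomp U1 U1' W1 W1' A1 B1 C1 U2 U2' W2 W2' A2 B2 C2
    (a1 : term U1 A1 C1 W1) (b1 : term U1' C1 B1 W1')
    (a2 : term U2 A2 C2 W2) (b2 : term U2' C2 B2 W2') :
    teq a1 a2 -> teq b1 b2 -> teq (tvcomp a1 b1) (tvcomp a2 b2)
| teq_hcompA U V1 V2 W A1 B1 A2 B2 A3 B3
    (a : term U A1 B1 V1) (b : term V1 A2 B2 V2) (c : term V2 A3 B3 W) :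
    teq (thcomp a (thcomp b c)) (thcomp (thcomp a b) c)
| teq_hcomp1c U A B W (a : term U A B W) : teq (thcomp (thid U) a) a
| teq_hcompc1 U A B W (a : term U A B W) : teq (thcomp a (thid W)) a
| teq_vcompA A C1 C2 B U1 W1 U2 W2 U3 W3
    (a : term U1 A C1 W1) (b : term U2 C1 C2 W2) (c : term U3 C2 B W3) :
    teq (tvcomp a (tvcomp b c)) (tvcomp (tvcomp a b) c)
| teq_vcomp1c U A B W (a : term U A B W) : teq (tvcomp (tvid A) a) a
| teq_vcompc1 U A B W (a : term U A B W) : teq (tvcomp a (tvid B)) a
| teq_hid1 : teq (thid 1) (tvid 1)
| teq_vidM A B : teq (tvid (A * B)) (thcomp (tvid A) (tvid B))
| teq_hidM U W : teq (thid (U * W)) (tvcomp (thid U) (thid W))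
| teq_interchange U U' V1 V1' W W' A B C A' B' C'
    (a : term U A C V1) (b : term U' C B V1')
    (c : term V1 A' C' W) (d : term V1' C' B' W') :
    teq (thcomp (tvcomp a b) (tvcomp c d)) (tvcomp (thcomp a c) (thcomp b d))
| teq_gen_comp A B C (f : hom A B) (g : hom B C) :
    teq (tgen (comp f g)) (tvcomp (tgen f) (tgen g))
| teq_gen_id A : teq (tgen (idm A)) (tvid A)
| teq_gen_tens A A' B B' (f : hom A A') (g : hom B B') :
    teq (tgen (tens f g)) (thcomp (tgen f) (tgen g))
| teq_yank_circ_h A : teq (thcomp (tputR A) (tgetL A)) (tvid A)
| teq_yank_circ_v A : teq (tvcomp (tgetL A) (tputR A)) (thid (circ A))
| teq_yank_bullet_h A : teq (thcomp (tgetR A) (tputL A)) (tvid A)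
| teq_yank_bullet_v A : teq (tvcomp (tgetR A) (tputL A)) (thid (bullet A)).

Lemma teq_boundary U A B W (a : term U A B W) U' A' B' W'
    (b : term U' A' B' W') :
  teq a b -> [/\ U = U', A = A', B = B' & W = W'].
Proof.
elim=> {U A B W a U' A' B' W' b} //=.
- by move=> U A B W U' A' B' W' a b _ [-> -> -> ->].
- by move=> U A B W U' A' B' W' U'' A'' B'' W'' a b c _ [-> -> -> ->] _ [-> -> -> ->].
- by move=> U1 V1 W1 A1 A1' B1 B1' U2 V2 W2 A2 A2' B2 B2' a1 b1 a2 b2
           _ [-> -> -> _] _ [_ -> -> ->].
- by move=> U1 U1' W1 W1' A1 B1 C1 U2 U2' W2 W2' A2 B2 C2 a1 b1 a2 b2
           _ [-> -> _ ->] _ [-> _ -> ->].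
all: by move=> *; split; rewrite ?mulgA ?mul1g ?mulg1.
Qed.

HB.instance Definition _ U A B W := gen_eqMixin (term U A B W).
HB.instance Definition _ U A B W := gen_choiceMixin (term U A B W).

Section Quotient.
Variables (U : V) (A B : M) (W : V).

Definition teqb (a b : term U A B W) := `[< teq a b >].

Lemma teqb_equiv : equiv_class_of teqb.
Proof.
split.
- by move=> a; apply/asboolP/teq_refl.
- by move=> a b; apply/asboolP/asboolP => /teq_sym.
- by move=> b a c /asboolP ab /asboolP bc; apply/asboolP/(teq_trans ab bc).
Qed.

Canonical teqb_equivRel := EquivRelPack teqb_equiv.

Definition fcell := {eq_quot teqb_equivRel}.

End Quotient.

Definition cls U A B W (a : term U A B W) : fcell U A B W := \pi a.

Definition fhcomp U V1 W A A' B B' (x : fcell U A B V1)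
    (y : fcell V1 A' B' W) : fcell U (A * A') (B * B') W :=
  cls (thcomp (repr x) (repr y)).

Definition fvcomp U U' W W' A B C (x : fcell U A C W) (y : fcell U' C B W') :
    fcell (U * U') A B (W * W') :=
  cls (tvcomp (repr x) (repr y)).

Lemma clsP U A B W (a b : term U A B W) : cls a = cls b <-> teq a b.
Proof.
split; first by move=> /eqmodP /asboolP.
by move=> ab; apply/eqmodP/asboolP.
Qed.

Lemma repr_cls U A B W (a : term U A B W) : teq (repr (cls a)) a.
Proof. by apply/clsP; rewrite /cls reprK. Qed.

Lemma cls_cast U A B W (a : term U A B W) U' A' B' W' (b : term U' A' B' W')
    eU eA eB eW :
  teq a b -> cast4 eU eA eB eW (cls a) = cls b.
Proof.
by case: U' / eU b; case: A' / eA; case: B' / eB; case: W' / eW => b /= /clsP.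
Qed.

Lemma fhcompE U V1 W A A' B B' (a : term U A B V1) (b : term V1 A' B' W) :
  fhcomp (cls a) (cls b) = cls (thcomp a b).
Proof. by apply/clsP; apply: teq_hcomp; apply: repr_cls. Qed.

Lemma fvcompE U U' W W' A B C (a : term U A C W) (b : term U' C B W') :
  fvcomp (cls a) (cls b) = cls (tvcomp a b).
Proof. by apply/clsP; apply: teq_vcomp; apply: repr_cls. Qed.

Lemma cls_ind U A B W (P : fcell U A B W -> Prop) :
  (forall a, P (cls a)) -> forall x, P x.
Proof. by move=> Pcls x; rewrite -[x]reprK; apply: Pcls. Qed.

Definition free_dblcat : dblcat M V.
Proof.
apply: (@DblCat _ _ fcell fhcomp fvcomp (fun U => cls (thid U))
                                        (fun A => cls (tvid A))).
- move=> U V1 V2 W A1 B1 A2 B2 A3 B3; do 3!elim/cls_ind=> ?.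
  by rewrite !fhcompE; apply: cls_cast; apply: teq_hcompA.
- move=> U A B W; elim/cls_ind=> a.
  by rewrite !fhcompE; apply: cls_cast; apply: teq_hcomp1c.
- move=> U A B W; elim/cls_ind=> a.
  by rewrite !fhcompE; apply: cls_cast; apply: teq_hcompc1.
- move=> A C1 C2 B U1 W1 U2 W2 U3 W3; do 3!elim/cls_ind=> ?.
  by rewrite !fvcompE; apply: cls_cast; apply: teq_vcompA.
- move=> U A B W; elim/cls_ind=> a.
  by rewrite !fvcompE; apply: cls_cast; apply: teq_vcomp1c.
- move=> U A B W; elim/cls_ind=> a.
  by rewrite !fvcompE; apply: cls_cast; apply: teq_vcompc1.
- by apply/clsP/teq_hid1.
- by move=> A B; rewrite fhcompE; apply/clsP/teq_vidM.
- by move=> U W; rewrite fvcompE; apply/clsP/teq_hidM.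
- move=> U U' V1 V1' W W' A B C A' B' C'; do 4!elim/cls_ind=> ?.
  by rewrite !(fhcompE, fvcompE); apply/clsP/teq_interchange.
Defined.

Definition free_cornering : cornering M.
Proof.
apply: (@Cornering _ free_dblcat (fun A B f => cls (tgen f))
         (fun A => cls (tgetL A)) (fun A => cls (tputR A))
         (fun A => cls (tgetR A)) (fun A => cls (tputL A))) => /=.
- by move=> A B C f g; rewrite fvcompE; apply/clsP/teq_gen_comp.
- by move=> A; apply/clsP/teq_gen_id.
- by move=> A A' B B' f g; rewrite fhcompE; apply/clsP/teq_gen_tens.
- by move=> A; rewrite fhcompE; apply: cls_cast; apply: teq_yank_circ_h.
- by move=> A; rewrite fvcompE; apply/clsP/teq_yank_circ_v.
- by move=> A; rewrite fhcompE; apply: cls_cast; apply: teq_yank_bullet_h.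
- by move=> A; rewrite fvcompE; apply/clsP/teq_yank_bullet_v.
Defined.

End FreeCornering.

(* Freeness: [free_cornering M] is initial among cornerings of [M], for maps of
   double categories that are the identity on both edge monoids. *)
Record cornering_map (M : symmoncat) (C D : cornering M)
    (F : forall U A B W, C U A B W -> D U A B W) : Prop := CorneringMap {
  map_hcomp : forall U V W A A' B B' (x : C U A B V) (y : C V A' B' W),
    F _ _ _ _ (hcomp x y) = hcomp (F _ _ _ _ x) (F _ _ _ _ y);
  map_vcomp : forall U U' W W' A B E (x : C U A E W) (y : C U' E B W'),
    F _ _ _ _ (vcomp x y) = vcomp (F _ _ _ _ x) (F _ _ _ _ y);
  map_hid : forall U, F _ _ _ _ (hid U) = hid U;
  map_vid : forall A, F _ _ _ _ (vid A) = vid A;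
  map_gen : forall A B (f : hom A B), F _ _ _ _ (gen C f) = gen D f;
  map_getL : forall A, F _ _ _ _ (getL A) = getL A;
  map_putR : forall A, F _ _ _ _ (putR A) = putR A;
  map_getR : forall A, F _ _ _ _ (getR A) = getR A;
  map_putL : forall A, F _ _ _ _ (putL A) = putL A
}.

Section Initiality.
Variables (M : symmoncat) (D : cornering M).

Fixpoint eval U A B W (a : term U A B W) : D U A B W :=
  match a with
  | tgen _ _ f => gen D f
  | tgetL A => getL A
  | tputR A => putR A
  | tgetR A => getR A
  | tputL A => putL A
  | thid U => hid U
  | tvid A => vid A
  | thcomp _ _ _ _ _ _ _ a b => hcomp (eval a) (eval b)
  | tvcomp _ _ _ _ _ _ _ a b => vcomp (eval a) (eval b)
  end.

Lemma cast4_irr U A B W U' A' B' W' (x : D U A B W)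
    (eU eU' : U = U') (eA eA' : A = A') (eB eB' : B = B') (eW eW' : W = W') :
  cast4 eU eA eB eW x = cast4 eU' eA' eB' eW' x.
Proof.
by case: U' / eU eU'; case: A' / eA eA'; case: B' / eB eB';
   case: W' / eW eW' => *; rewrite !cast4_id.
Qed.

Lemma eval_teq U A B W (a : term U A B W) U' A' B' W' (b : term U' A' B' W') :
  teq a b -> forall eU eA eB eW, cast4 eU eA eB eW (eval a) = eval b.
Proof.
elim=> {U A B W a U' A' B' W' b} /=; try by move=> *; rewrite cast4_id.
- move=> U A B W U' A' B' W' a b ab IH eU eA eB eW.
  case: U / eU a ab IH => a ab IH; case: A / eA a ab IH => a ab IH.
  case: B / eB a ab IH => a ab IH; case: W / eW a ab IH => a ab IH.
  by rewrite /= -(IH erefl erefl erefl erefl).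
- move=> U A B W U' A' B' W' U'' A'' B'' W'' a b c ab IH bc IH'.
  case: (teq_boundary ab) => eU eA eB eW.
  case: U' / eU b ab bc IH IH'; case: A' / eA; case: B' / eB; case: W' / eW.
  by move=> b ab bc IH IH' *; rewrite -IH' -(IH erefl erefl erefl erefl).
- move=> U1 V1 W1 A1 A1' B1 B1' U2 V2 W2 A2 A2' B2 B2' a1 b1 a2 b2 a12 IHa b12.
  case: (teq_boundary a12) (teq_boundary b12) => eU eA eB eV [_ eA' eB' eW].
  case: U2 / eU a2 a12 IHa; case: A2 / eA; case: B2 / eB.
  case: V2 / eV b2 b12; case: A2' / eA'; case: B2' / eB'; case: W2 / eW.
  move=> b2 _ a2 _ IHa IHb *.
  by rewrite cast4_id -(IHa erefl erefl erefl erefl) -(IHb erefl erefl erefl erefl).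
- move=> U1 U1' W1 W1' A1 B1 C1 U2 U2' W2 W2' A2 B2 C2 a1 b1 a2 b2 a12 IHa b12.
  case: (teq_boundary a12) (teq_boundary b12) => eU eA eC eW [eU' _ eB eW'].
  case: U2 / eU a2 a12 IHa; case: A2 / eA; case: W2 / eW.
  case: C2 / eC b2 b12; case: U2' / eU'; case: B2 / eB; case: W2' / eW'.
  move=> b2 _ a2 _ IHa IHb *.
  by rewrite cast4_id -(IHa erefl erefl erefl erefl) -(IHb erefl erefl erefl erefl).
- by move=> *; rewrite -hcompA; apply: cast4_irr.
- by move=> U A B W a *; rewrite -[RHS]hcomp1c; apply: cast4_irr.
- by move=> U A B W a *; rewrite -[RHS]hcompc1; apply: cast4_irr.
- by move=> *; rewrite -vcompA; apply: cast4_irr.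
- by move=> U A B W a *; rewrite -[RHS]vcomp1c; apply: cast4_irr.
- by move=> U A B W a *; rewrite -[RHS]vcompc1; apply: cast4_irr.
- by move=> *; rewrite cast4_id hid1.
- by move=> *; rewrite cast4_id vidM.
- by move=> *; rewrite cast4_id hidM.
- by move=> *; rewrite cast4_id interchange.
- by move=> *; rewrite cast4_id gen_comp.
- by move=> *; rewrite cast4_id gen_id.
- by move=> *; rewrite cast4_id gen_tens.
- by move=> A *; rewrite -yank_circ_h; apply: cast4_irr.
- by move=> A *; rewrite cast4_id yank_circ_v.
- by move=> A *; rewrite -yank_bullet_h; apply: cast4_irr.
- by move=> A *; rewrite cast4_id yank_bullet_v.
Qed.

Theorem free_cornering_initial :
  exists2 F : forall U A B W, free_cornering M U A B W -> D U A B W,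
    cornering_map F
    & forall G, cornering_map G ->
        forall U A B W (x : free_cornering M U A B W),
          G U A B W x = F U A B W x.
Proof.
pose F U A B W (x : free_cornering M U A B W) := eval (repr (x : fcell _ _ _ _)).
have FE U A B W (a : term U A B W) : F _ _ _ _ (cls a) = eval a.
  by rewrite /F; apply: (eval_teq (repr_cls a) erefl erefl erefl erefl).
exists F.
  by split=> *; apply: FE.
move=> G [Gh Gv Ghi Gvi Gg GgL GpR GgR GpL] U A B W; elim/cls_ind=> a.
rewrite FE; elim: a => {U A B W} //=.
- by move=> U V1 W A A' B B' a <- b <-; rewrite -Gh -fhcompE.
- by move=> U U' W W' A B C a <- b <-; rewrite -Gv -fvcompE.
Qed.

End Initiality.

(* Main.v *)
(** The equations hold in every cornering.  The clauses for the unit and the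
    tensor of exchanges, with interchange, reduce both of them to a single
    symbol.  For (i), stagger the two crossing cells vertically so that the
    [put] of one of them meets the [get] of the other in a common row, where
    they cancel by yanking; what remains is the hexagon for the braiding.  For
    (ii), the braiding with the unit is invertible and, by the hexagon,
    idempotent, hence trivial, which leaves the vertical yanking equation. *)
Require Import Defs.
From mathcomp Require Import all_boot.
(* ssrfun also has [comp], [compA] and [interchange]. *)
Import Defs.

Set Implicit Arguments.
Unset Strict Implicit.
Unset Printing Implicit Defensive.

Local Open Scope group_scope.

(** * Double-category calculus up to transport of boundaries *)

Section CellEquality.
Variables (H V : monoidType) (D : dblcat H V).

(* Equality of cells up to transport along equations between boundaries. *)
Inductive ceq U A B W (a : D U A B W) :
    forall U' A' B' W', D U' A' B' W' -> Prop :=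
  ceq_refl : ceq a a.

(** Boundaries have decidable equality, so transport along a loop is trivial; hence [ceq] collapses
    to plain equality once the boundaries agree. *)
Lemma ceq_cast4_eq U A B W (a : D U A B W) U' A' B' W' (b : D U' A' B' W') :
  ceq a b -> forall eU eA eB eW, cast4 eU eA eB eW a = b.
Proof. by case=> *; rewrite cast4_id. Qed.

Lemma ceq_eq U A B W (a b : D U A B W) : ceq a b -> a = b.
Proof. by move=> ab; apply: (ceq_cast4_eq ab erefl erefl erefl erefl). Qed.

Lemma eq_ceq U A B W (a b : D U A B W) : a = b -> ceq a b.
Proof. by move=> ->; apply: ceq_refl. Qed.

Lemma cast4_ceq U A B W (a : D U A B W) U' A' B' W' (b : D U' A' B' W')
    eU eA eB eW : cast4 eU eA eB eW a = b -> ceq a b.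
Proof.
by case: U' / eU b; case: A' / eA; case: B' / eB; case: W' / eW => b /= <-.
Qed.

Lemma ceq_sym U A B W (a : D U A B W) U' A' B' W' (b : D U' A' B' W') :
  ceq a b -> ceq b a.
Proof. by case. Qed.

Lemma ceq_cast4 U A B W (a : D U A B W) U' A' B' W' eU eA eB eW :
  ceq (cast4 eU eA eB eW a : D U' A' B' W') a.
Proof. exact: ceq_sym (cast4_ceq (erefl _)). Qed.

Lemma ceq_trans U A B W (a : D U A B W) U' A' B' W' (b : D U' A' B' W')
    U'' A'' B'' W'' (c : D U'' A'' B'' W'') :
  ceq a b -> ceq b c -> ceq a c.
Proof. by move=> ab; case. Qed.

Lemma ceq_hcomp U1 V1 W1 A1 A1' B1 B1' U2 V2 W2 A2 A2' B2 B2'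
    (a1 : D U1 A1 B1 V1) (b1 : D V1 A1' B1' W1)
    (a2 : D U2 A2 B2 V2) (b2 : D V2 A2' B2' W2) :
  ceq a1 a2 -> ceq b1 b2 -> ceq (hcomp a1 b1) (hcomp a2 b2).
Proof.
move=> a12; case: U2 A2 B2 V2 a2 / a12 b2 => b2 b12.
(* Destructing [b12] in the goal would abstract the left boundary that [a1] shares; the other three
   are substituted instead, and [ceq_eq] does the rest. *)
have [eA eB eW] : [/\ A1' = A2', B1' = B2' & W1 = W2] by case: b12.
case: A2' / eA b2 b12; case: B2' / eB; case: W2 / eW => b2 /ceq_eq ->.
exact: ceq_refl.
Qed.

Lemma ceq_vcomp U1 U1' W1 W1' A1 B1 C1 U2 U2' W2 W2' A2 B2 C2
    (a1 : D U1 A1 C1 W1) (b1 : D U1' C1 B1 W1')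
    (a2 : D U2 A2 C2 W2) (b2 : D U2' C2 B2 W2') :
  ceq a1 a2 -> ceq b1 b2 -> ceq (vcomp a1 b1) (vcomp a2 b2).
Proof.
move=> a12; case: U2 A2 C2 W2 a2 / a12 b2 => b2 b12.
have [eU eB eW] : [/\ U1' = U2', B1 = B2 & W1' = W2'] by case: b12.
case: U2' / eU b2 b12; case: B2 / eB; case: W2' / eW => b2 /ceq_eq ->.
exact: ceq_refl.
Qed.

Lemma ceq_hcompA U V1 V2 W A1 B1 A2 B2 A3 B3
    (a : D U A1 B1 V1) (b : D V1 A2 B2 V2) (c : D V2 A3 B3 W) :
  ceq (hcomp a (hcomp b c)) (hcomp (hcomp a b) c).
Proof. exact: cast4_ceq (hcompA a b c). Qed.

Lemma ceq_hcompc1 U A B (a : D U A B 1) : ceq (hcomp a (vid 1)) a.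
Proof. by rewrite -hid1; apply: cast4_ceq (hcompc1 a). Qed.

Lemma ceq_hcomp1c W A B (a : D 1 A B W) : ceq (hcomp (vid 1) a) a.
Proof. by rewrite -hid1; apply: cast4_ceq (hcomp1c a). Qed.

Lemma ceq_vcompA A C1 C2 B U1 W1 U2 W2 U3 W3
    (a : D U1 A C1 W1) (b : D U2 C1 C2 W2) (c : D U3 C2 B W3) :
  ceq (vcomp a (vcomp b c)) (vcomp (vcomp a b) c).
Proof. exact: cast4_ceq (vcompA a b c). Qed.

Lemma ceq_vcomp1c U A B W (a : D U A B W) : ceq (vcomp (vid A) a) a.
Proof. exact: cast4_ceq (vcomp1c a). Qed.

Lemma ceq_vcompc1 U A B W (a : D U A B W) : ceq (vcomp a (vid B)) a.
Proof. exact: cast4_ceq (vcompc1 a). Qed.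

Lemma ceq_vid A B : A = B -> ceq (vid A : D _ _ _ _) (vid B : D _ _ _ _).
Proof. by move=> ->; apply: ceq_refl. Qed.

(** Identity rows alter the side boundaries only by units. With [ceq_vpad2r], this brings two
    three-row cells to the common height of five. *)
Lemma ceq_vpad2l U A B W (a : D U A B W) :
  ceq a (vcomp (vid A) (vcomp (vid A) a)).
Proof.
by apply: ceq_sym; apply: (ceq_trans (ceq_vcomp1c _)); apply: ceq_vcomp1c.
Qed.

Lemma ceq_vpad2r U1 U2 U3 W1 W2 W3 A0 A1 A2 A3
    (a : D U1 A0 A1 W1) (b : D U2 A1 A2 W2) (c : D U3 A2 A3 W3) :
  ceq (vcomp a (vcomp b c))
      (vcomp a (vcomp b (vcomp c (vcomp (vid A3) (vid A3))))).
Proof.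
apply: ceq_vcomp (ceq_refl a) _; apply: ceq_vcomp (ceq_refl b) _.
apply: ceq_sym; apply: ceq_trans (ceq_vcompc1 c).
by apply: ceq_vcomp (ceq_refl c) _; apply: ceq_vcompc1.
Qed.

(* [x] occupies the first three and [y] the last three of five rows. *)
Lemma ceq_stagger_down V' U1 U2 U3 W1 W2 W3 U W A0 A1 A2 A3 B0 B1 B2 B3
    A A' B B'
    (a : D U1 A0 A1 1) (b : D U2 A1 A2 1) (c : D U3 A2 A3 V')
    (a' : D V' B0 B1 W1) (b' : D 1 B1 B2 W2) (c' : D 1 B2 B3 W3)
    (x : D U A A' V') (y : D V' B B' W) :
  ceq x (vcomp a (vcomp b c)) -> ceq y (vcomp a' (vcomp b' c')) ->
  ceq (hcomp x y)
    (vcomp (hcomp a (vid B0)) (vcomp (hcomp b (vid B0)) (vcomp (hcomp c a')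
      (vcomp (hcomp (vid A3) b') (hcomp (vid A3) c'))))).
Proof.
move=> xE yE; rewrite -!interchange; apply: ceq_hcomp.
  exact: ceq_trans xE (ceq_vpad2r _ _ _).
exact: ceq_trans yE (ceq_vpad2l _).
Qed.

(** The variant for A•: the common boundary leaves [x] in its first row and enters [y] in its last,
    so [y] is placed higher. *)
Lemma ceq_stagger_up V' U1 U2 U3 W1 W2 W3 U W A0 A1 A2 A3 B0 B1 B2 B3 A A' B B'
    (a : D U1 A0 A1 V') (b : D U2 A1 A2 1) (c : D U3 A2 A3 1)
    (a' : D 1 B0 B1 W1) (b' : D 1 B1 B2 W2) (c' : D V' B2 B3 W3)
    (x : D U A A' V') (y : D V' B B' W) :
  ceq x (vcomp a (vcomp b c)) -> ceq y (vcomp a' (vcomp b' c')) ->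
  ceq (hcomp x y)
    (vcomp (hcomp (vid A0) a') (vcomp (hcomp (vid A0) b') (vcomp (hcomp a c')
      (vcomp (hcomp b (vid B3)) (hcomp c (vid B3)))))).
Proof.
move=> xE yE; rewrite -!interchange; apply: ceq_hcomp.
  exact: ceq_trans xE (ceq_vpad2l _).
exact: ceq_trans yE (ceq_vpad2r _ _ _).
Qed.

(** Once the middle row is an identity, its two neighbours become adjacent and merge into [s]. *)
Lemma ceq_vcomp_cancel U1 U2 U3 U4 U5 W1 W2 W3 W4 W5 A0 A1 A2 A3 A4 A5
    (a : D U1 A0 A1 W1) (b : D U2 A1 A2 W2) (z : D U3 A2 A3 W3)
    (c : D U4 A3 A4 W4) (d : D U5 A4 A5 W5)
    U1' U2' U' U4' U5' W1' W2' W' W4' W5' B0 B1 B4 B5 E1 E2 E3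
    (a' : D U1' B0 B1 W1') (b' : D U2' E1 E2 W2') (c' : D U4' E2 E3 W4')
    (d' : D U5' B4 B5 W5') (s : D U' B1 B4 W') :
  ceq a a' -> ceq b b' -> ceq z (vid E2 : D _ _ _ _) -> ceq c c' ->
  ceq d d' -> ceq (vcomp b' c') s ->
  ceq (vcomp a (vcomp b (vcomp z (vcomp c d)))) (vcomp a' (vcomp s d')).
Proof.
move=> aE bE zE cE dE sE; apply: ceq_vcomp aE _.
(* The bottom of [c'] must be literally the top of [d] for the two to compose. *)
have eA4 : A4 = E3 by case: cE.
case: E3 / eA4 c' cE sE => c' cE sE.
apply: (ceq_trans (ceq_vcomp bE (ceq_vcomp zE (ceq_vcomp cE (ceq_refl d))))).
apply: (ceq_trans (ceq_vcomp (ceq_refl b') (ceq_vcomp1c _))).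
apply: (ceq_trans (ceq_vcompA b' c' d)).
exact: ceq_vcomp sE dE.
Qed.

End CellEquality.

(** * The hexagon for the inverse braiding *)

Section Braiding.
Variable M : symmoncat.

Lemma cast2_comp_id (A B A' B' : M) (f : hom A B) (g : hom B A)
    (eA eA' : A = A') (eB eB' : B = B') :
  comp f g = idm A -> comp (cast2 eA eB f) (cast2 eB' eA' g) = idm A'.
Proof.
by case: A' / eA eA'; case: B' / eB eB' => e e' /=; rewrite !eq_axiomK.
Qed.

(* Both sides are inverse to the two sides of [braid_hex]. *)
Lemma braid_hex_inv (A B C : M) :
  cast2 (esym (mulgA B C A)) (mulgA A B C) (braid (B * C) A)
  = comp (cast2 erefl (mulgA B A C) (tens (idm B) (braid C A)))
      (tens (braid B A) (idm C)).
Proof.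
set y := LHS; set x := RHS.
pose p := cast2 (mulgA A B C) (esym (mulgA B C A)) (braid A (B * C)).
have py : comp p y = idm _ by apply: cast2_comp_id; apply: braid_sym.
have xp : comp x p = idm _.
  rewrite /x /p braid_hex -compA [comp (tens _ _) (comp _ _)]compA.
  rewrite -tens_comp braid_sym comp1f tens_id comp1f.
  by apply: cast2_comp_id; rewrite -tens_comp braid_sym comp1f tens_id.
by rewrite -[x]compf1 -py compA xp comp1f.
Qed.

End Braiding.

(** * Crossing cells at the unit and at a tensor of objects *)

Section Crossings.
Variables (M : symmoncat) (D : cornering M).

Lemma ceq_gen_cast2 A B A' B' (f : hom A B) eA eB :
  ceq (gen D f) (gen D (cast2 eA eB f : hom A' B')).
Proof. by case: A' / eA; case: B' / eB; apply: ceq_refl. Qed.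

Lemma ceq_gen_comp A B C (f : hom A B) (g : hom B C) :
  ceq (gen D (comp f g)) (vcomp (gen D f) (gen D g)).
Proof. by rewrite gen_comp; apply: ceq_refl. Qed.

Lemma ceq_gen_braid (A B B' : M) : B = B' ->
  ceq (gen D (braid A B)) (gen D (braid A B')).
Proof. by move=> ->; apply: ceq_refl. Qed.

Lemma gen_braid_unit (A : M) :
  ceq (gen D (braid A 1)) (vid A : D _ _ _ _) /\
  ceq (gen D (braid 1 A)) (vid A : D _ _ _ _).
Proof.
pose s := gen D (cast2 (mulg1 A) (mul1g A) (braid A 1)).
pose t := gen D (cast2 (mul1g A) (mulg1 A) (braid 1 A)).
have sE : ceq (gen D (braid A 1)) s by apply: ceq_gen_cast2.
have tE : ceq (gen D (braid 1 A)) t by apply: ceq_gen_cast2.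
have st : vcomp s t = vid A.
  by rewrite -gen_comp cast2_comp_id ?gen_id //; apply: braid_sym.
(* The hexagon at [B = C = 1]: both of its factors are the braiding of [A] with the unit. *)
have ss : ceq s (vcomp s s).
  apply: (ceq_trans (ceq_sym sE)).
  apply: (ceq_trans (ceq_gen_braid _ (esym (mulg1 1)))).
  apply: (ceq_trans (ceq_gen_cast2 _ (mulgA A 1 1) (esym (mulgA 1 1 A)))).
  rewrite braid_hex; apply: (ceq_trans (ceq_gen_comp _ _)).
  rewrite gen_tens gen_id; apply: ceq_vcomp.
    exact: ceq_trans (ceq_hcompc1 _) sE.
  apply: (ceq_trans (ceq_sym (ceq_gen_cast2 _ _ _))).
  by rewrite gen_tens gen_id; apply: (ceq_trans (ceq_hcomp1c _)).
(* s = s(st) = (ss)t = st = 1; below, t = 1t = st = 1. *)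
have s1 : ceq s (vid A : D _ _ _ _).
  apply: (ceq_trans (ceq_sym (ceq_vcompc1 s))); rewrite -st.
  apply: (ceq_trans (ceq_vcompA s s t)).
  exact: ceq_vcomp (ceq_sym ss) (ceq_refl t).
split; first exact: ceq_trans sE s1.
apply: (ceq_trans tE); apply: (ceq_trans (ceq_sym (ceq_vcomp1c t))).
rewrite -{2}st; exact: ceq_vcomp (ceq_sym s1) (ceq_refl t).
Qed.

Lemma chi_circE (A B : M) :
  ceq (chi_circ D A B)
    (vcomp (hcomp (getL A) (vid B))
      (vcomp (gen D (braid A B)) (hcomp (vid B) (putR A)))).
Proof. exact: ceq_cast4. Qed.

Lemma chi_bulletE (A B : M) :
  ceq (chi_bullet D A B)
    (vcomp (hcomp (vid B) (getR A))
      (vcomp (gen D (braid B A)) (hcomp (putL A) (vid B)))).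
Proof. exact: ceq_cast4. Qed.

Lemma chi_symb_unit (s : M + M) : chi_symb D s 1 = hid ([:: s] : exchange M).
Proof.
apply: ceq_eq; case: s => A.
  apply: (ceq_trans (chi_circE A 1)).
  apply: ceq_trans (eq_ceq (yank_circ_v D A)).
  apply: ceq_vcomp; first exact: ceq_hcompc1.
  apply: (ceq_trans (ceq_vcomp (gen_braid_unit A).1 (ceq_hcomp1c (putR A)))).
  exact: ceq_vcomp1c.
apply: (ceq_trans (chi_bulletE A 1)).
apply: ceq_trans (eq_ceq (yank_bullet_v D A)).
apply: ceq_vcomp; first exact: ceq_hcomp1c.
apply: (ceq_trans (ceq_vcomp (gen_braid_unit A).2 (ceq_hcompc1 (putL A)))).
exact: ceq_vcomp1c.
Qed.

(** The left crossing is placed higher, so that its last row, with [putR A], meets the first row of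
    the right one, with [getL A]. *)
Lemma chi_circM (A B C : M) :
  ceq (chi_circ D A (B * C)) (hcomp (chi_circ D A B) (chi_circ D A C)).
Proof.
apply: ceq_sym.
apply: (ceq_trans (ceq_stagger_down (chi_circE A B) (chi_circE A C))).
apply: ceq_trans (ceq_sym (chi_circE A (B * C))).
(* The witnesses are the two factors of [braid_hex], the second transported so that they compose. *)
apply: (ceq_vcomp_cancel
  (b' := hcomp (gen D (braid A B)) (vid C))
  (c' := gen D (cast2 (mulgA B A C) erefl (tens (idm B) (braid A C))))).
(* The padding is [vid (1 * C)], as the top of [hcomp (getL A) (vid C)] is [1 * C]; lower down it is
   [vid (B * 1)]. *)
- apply: (ceq_trans (ceq_sym (ceq_hcompA _ _ _))).
  rewrite (vidM _ B C).
  apply: ceq_hcomp (ceq_refl _) (ceq_hcomp (ceq_refl _) _).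
  exact: ceq_vid (mul1g C).
- exact: ceq_hcomp (ceq_refl _) (ceq_vid _ (mul1g C)).
(* Reassociating makes [putR A] and [getL A] adjacent. *)
- apply: (ceq_trans (ceq_hcompA _ _ _)); rewrite vidM.
  apply: ceq_hcomp (ceq_refl _).
  apply: (ceq_trans (ceq_sym (ceq_hcompA _ _ _))); rewrite vidM.
  exact: ceq_hcomp (ceq_refl _) (cast4_ceq (yank_circ_h D A)).
- apply: ceq_trans (ceq_gen_cast2 _ _ _); rewrite gen_tens gen_id.
  exact: ceq_hcomp (ceq_vid _ (mulg1 B)) (ceq_refl _).
- apply: (ceq_trans (ceq_hcompA _ _ _)); apply: ceq_hcomp (ceq_refl _).
  rewrite (vidM _ B C); exact: ceq_hcomp (ceq_vid _ (mulg1 B)) (ceq_refl _).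
apply: ceq_trans (ceq_sym (ceq_gen_cast2 _ (mulgA A B C) (esym (mulgA B C A)))).
rewrite braid_hex; apply: ceq_trans (ceq_sym (ceq_gen_comp _ _)).
by rewrite gen_tens gen_id; apply: ceq_refl.
Qed.

(** Now the right crossing is placed higher, so A passes [C] before [B], which is the order of the
    factors in [braid_hex_inv]. *)
Lemma chi_bulletM (A B C : M) :
  ceq (chi_bullet D A (B * C)) (hcomp (chi_bullet D A B) (chi_bullet D A C)).
Proof.
apply: ceq_sym.
apply: (ceq_trans (ceq_stagger_up (chi_bulletE A B) (chi_bulletE A C))).
apply: ceq_trans (ceq_sym (chi_bulletE A (B * C))).
apply: (ceq_vcomp_cancel
  (b' := gen D (cast2 erefl (mulgA B A C) (tens (idm B) (braid C A))))
  (c' := hcomp (gen D (braid B A)) (vid C))).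
- apply: (ceq_trans (ceq_hcompA _ _ _)); apply: ceq_hcomp (ceq_refl _).
  rewrite (vidM _ B C); exact: ceq_hcomp (ceq_vid _ (mulg1 B)) (ceq_refl _).
- apply: ceq_trans (ceq_gen_cast2 _ _ _); rewrite gen_tens gen_id.
  exact: ceq_hcomp (ceq_vid _ (mulg1 B)) (ceq_refl _).
- apply: (ceq_trans (ceq_hcompA _ _ _)); rewrite vidM.
  apply: ceq_hcomp (ceq_refl _).
  apply: (ceq_trans (ceq_sym (ceq_hcompA _ _ _))); rewrite vidM.
  exact: ceq_hcomp (ceq_refl _) (cast4_ceq (yank_bullet_h D A)).
- exact: ceq_hcomp (ceq_refl _) (ceq_vid _ (mul1g C)).
- apply: (ceq_trans (ceq_sym (ceq_hcompA _ _ _))).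
  rewrite (vidM _ B C).
  apply: ceq_hcomp (ceq_refl _) (ceq_hcomp (ceq_refl _) _).
  exact: ceq_vid (mul1g C).
apply: ceq_trans (ceq_sym (ceq_gen_cast2 _ (esym (mulgA B C A)) (mulgA A B C))).
rewrite braid_hex_inv; apply: ceq_trans (ceq_sym (ceq_gen_comp _ _)).
by rewrite gen_tens gen_id; apply: ceq_refl.
Qed.

Lemma chi_symbM (s : M + M) (A B : M) :
  chi_symb D s (A * B) = hcomp (chi_symb D s A) (chi_symb D s B).
Proof.
by apply: ceq_eq; case: s => C; [apply: chi_circM | apply: chi_bulletM].
Qed.

Lemma chi_tensor (U : exchange M) (A B : M) :
  chi D U (A * B) = hcomp (chi D U A) (chi D U B).
Proof.
elim: U => [|s U IH] /=; first exact: vidM.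
rewrite chi_symbM IH; apply: esym.
exact: (interchange (chi_symb D s A) (chi D U A) (chi_symb D s B) (chi D U B)).
Qed.

Lemma chi_unit (U : exchange M) : chi D U 1 = hid U.
Proof.
elim: U => [|s U IH] /=; first by rewrite hid1.
by rewrite chi_symb_unit IH -hidM.
Qed.

End Crossings.

Theorem lemma1 (M : symmoncat) (U : exchange M) (A B : M) :
  let D := free_cornering M in
  chi D U (A * B) = hcomp (chi D U A) (chi D U B) /\ chi D U 1 = hid U.
Proof. by split; [apply: chi_tensor | apply: chi_unit]. Qed.
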